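(* Let $p$ be a prime, $k\ge2$, and let $\partial_{k+1}$ be the map on $F\otimes_{ku_*}ku_*(\mathbb{Z}_{p^2})$ described in the context. Then: (a) $\partial_{k+1}([1,kg_1+1])=u\,p\,v^{kg_1}[1,1]$ for some unit $u\in ku_*$; (b) there exist an element $x$ of lower filtration than $p[p,(pk+1)g_1+1]$ and a unit $u'\in ku_*$ such that $\partial_{k+1}\big(p[p,(pk+1)g_1+1]+x\big)=u'\,v^{(kp+2)g_1}[1,1]$.
   Context: Fix a prime $p$; $ku_*=\mathbb{Z}_{(p)}[v]$, $v$ of degree 2; $g_1=p-1$. For $m\ge1$, $0\le t\le p^m-1$, let $a_{t,m}=\binom{p^m}{t+1}v^t$. The reduced $ku_*(\mathbb{Z}_{p^2})$ is the $ku_*$-module generated by $e_j$ ($j\ge1$) with relations $\sum_{t=0}^{p^2-1}a_{t,2}e_{j-t}=0$ for all $j\ge1$ ($e_h=0$ for $h\le0$). $F$ is the free $ku_*$-module on $\alpha_i$, $i\ge1$ ($\alpha_h=0$ for $h\le0$); $[i,j]=\alpha_i\otimes e_j\in F\otimes_{ku_*}ku_*(\mathbb{Z}_{p^2})$, zero if $i\le0$ or $j\le0$; $c[i,j]=c\,\alpha_i\otimes e_j$. The $ku_*$-linear map $\partial_{k+1}$ is $\partial_{k+1}([i,j])=\sum_{t=0}^{p^{k+1}-1}a_{t,k+1}[i-t,j]$; its cokernel is $ku_*(\mathbb{Z}_{p^{k+1}})\otimes_{ku_*}ku_*(\mathbb{Z}_{p^2})$. Filtration: $c[i,j]$ has filtration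 $i(p^{k+1}+1)+j(p^k+1)$; an element is of lower filtration than $c[a,b]$ if it is a $ku_*$-linear combination of elements $[i,j]$ of strictly smaller filtration. *)

(* Defs.v *)
From mathcomp Require Import all_boot all_order all_algebra.
Set Implicit Arguments. Unset Strict Implicit. Unset Printing Implicit Defensive.
Import Order.TTheory GRing.Theory Num.Theory.
Local Open Scope ring_scope.

(* ku_* = Z_(p)[v] is modelled as the subring of {poly rat} (variable 'X = v)
   of polynomials whose coefficients are p-local rationals. *)
Definition plocal (p : nat) (q : rat) : bool := ~~ (p %| `|denq q|)%N.
Definition in_ku (p : nat) (c : {poly rat}) : bool := all (plocal p) c.
Definition ku_unit (p : nat) (u : {poly rat}) : Prop :=
  in_ku p u /\ exists w, in_ku p w /\ u * w = 1.

Definition g1 (p : nat) : nat := (p - 1)%N.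

Definition acoef (p m t : nat) : {poly rat} := ('C(p ^ m, t.+1))%:R * 'X^t.

(* A formal term c[i,j]; an element of the free ku_*-module on the [i,j]
   is a finite list of terms (their sum).  [i,j] = 0 when i <= 0 or j <= 0:
   only coefficients at positive (i,j) are ever compared. *)
Definition term := ({poly rat} * (int * int))%type.
Definition coefAt (s : seq term) (i j : int) : {poly rat} :=
  \sum_(t <- s | t.2 == (i, j)) t.1.
Definition scale (c : {poly rat}) (s : seq term) : seq term :=
  [seq (c * t.1, t.2) | t <- s].

(* relation of ku_*(Z_{p^2}) in column i, row j: sum_{t<p^2} a_{t,2} [i, j-t] *)
Definition relM (p : nat) (i j : int) : seq term :=
  [seq (acoef p 2 t, (i, j - t%:Z)) | t <- iota 0 (p ^ 2)].
Definition relcomb (p : nat) (r : seq term) : seq term :=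
  flatten [seq scale t.1 (relM p t.2.1 t.2.2) | t <- r].

(* equality in F (x)_{ku_*} ku_*(Z_{p^2}): the difference is a ku_*-linear
   combination of relations. *)
Definition tens_eq (p : nat) (x y : seq term) : Prop :=
  exists r : seq term, all (fun t : term => in_ku p t.1) r /\
    forall i j : int, 0 < i -> 0 < j ->
      coefAt x i j - coefAt y i j = coefAt (relcomb p r) i j.

Definition bd (p m : nat) (s : seq term) : seq term :=
  flatten [seq [seq (t.1 * acoef p m u, (t.2.1 - u%:Z, t.2.2)) | u <- iota 0 (p ^ m)]
          | t <- s].

Definition filt (p k : nat) (ij : int * int) : int :=
  ij.1 * ((p ^ k.+1)%:Z + 1) + ij.2 * ((p ^ k)%:Z + 1).

(* Main.v *)
Require Import Defs.
From mathcomp Require Import all_boot all_order all_algebra.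
From mathcomp Require Import ring zify.
Import Order.TTheory GRing.Theory Num.Theory.
Local Open Scope ring_scope.

(* Let x and y be the operators lowering i and j.  By homogeneity in v everything
   takes place over Z in the variables vx and z = vy: in top degree [i0,j0] an
   element is a polynomial f(vx,z) modulo (vx)^i0, z^j0 and P_2(z), and the boundary
   is multiplication by P_{k+1}(vx), where P_m(z) = ((1+z)^(p^m) - 1)/z.  The factor
   G_m = P_{m+1}/P_m is Eisenstein: G_m = p U_m + z^(p^m g) with U_m(0) = 1, g = p-1.

   From P_2 = G_0 G_1 one gets, modulo P_2,
     (p U_0)^m G_1 = (-z^g)^m G_1   and   (p U_1)^m G_0 = (-z^(pg))^m G_0.
   The first family gives (a).  For (b), with n = (pk+1)g + 1 and modulo (P_2, z^n),
   the second gives p^(k+1) G_0 = 0 and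
     p^k G_0 = (-1)^k z^(n-1) + (unit) p z^(kpg),
   and the last term is p^(k+1) b(z) for some b, because p z^(kpg) is a unit times
   z^(kpg) G_1, and kpg >= (k+1)g lets the first family produce p^(k+1).
   As P_{k+1}(x) is a unit times p^(k+1) + p^k x^g modulo x^p (absorbing v into x),
   the element G_0(z) - x^g b(z), whose constant coefficient is p, has boundary
   (-1)^k x^g z^(n-1). *)

(** * The Eisenstein form of G_m and the truncation of P_m *)

(* [pseries p m] is ((1 + 'X)^(p^m) - 1) / 'X: [acoef p m] with v absorbed in the variable. *)
Definition pseries (p m : nat) : {poly int} :=
  \sum_(t < p ^ m) ('C(p ^ m, t.+1))%:R * 'X^t.

Definition cyclo (p m : nat) : {poly int} := \sum_(i < p) ((1 + 'X) ^+ (p ^ m)) ^+ i.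

Lemma exprD_prime (R : comNzRingType) (p : nat) (a b : R) : prime p ->
  exists c, (a + b) ^+ p = a ^+ p + b ^+ p + p%:R * c.
Proof.
move=> pp; have p0 := prime_gt0 pp.
exists (\sum_(i < p.-1) a ^+ (p - i.+1) * b ^+ i.+1 *+ ('C(p, i.+1) %/ p)).
case: p pp p0 => // n pp _ /=; rewrite exprDn big_ord_recl big_ord_recr /=.
rewrite subn0 bin0 expr0 mulr1 mulr1n /bump /= add1n subnn binn expr0 mul1r mulr1n.
rewrite [in LHS]addrA addrAC; congr (_ + _).
rewrite mulr_sumr; apply: eq_bigr => i _; rewrite add1n.
rewrite mulrnAr mulr_natl -mulrnA mulnC divnK //.
by apply: prime_dvd_bin => //; have := ltn_ord i; lia.
Qed.

Lemma exprD_mulp (R : comNzRingType) (p n : nat) (a b : R) :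
  exists c, (a + p%:R * b) ^+ n = a ^+ n + p%:R * c.
Proof.
elim: n => [|n [c IH]]; first by exists 0; rewrite !expr0 mulr0 addr0.
by exists (a ^+ n * b + c * (a + p%:R * b)); rewrite exprSr IH exprSr; ring.
Qed.

Lemma expr1DX_modp (p m : nat) : prime p ->
  exists c : {poly int}, (1 + 'X) ^+ (p ^ m) = 1 + 'X^(p ^ m) + p%:R * c.
Proof.
move=> pp; elim: m => [|m [c IH]].
  by exists 0; rewrite expn0 !expr1 mulr0 addr0.
have [d Hd] := @exprD_mulp _ p p (1 + 'X^(p ^ m)) c.
have [e He] := exprD_prime _ p (1 : {poly int}) 'X^(p ^ m) pp.
exists (e + d); rewrite expnSr exprM IH Hd He expr1n -exprM; ring.
Qed.

Lemma polyXM_const (h : {poly int}) : exists t, h = (h.[0])%:P + 'X * t.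
Proof.
elim/poly_ind: h => [|q c _]; first by exists 0; rewrite horner0 mulr0 addr0.
by exists q; rewrite !hornerE addrC commr_polyX.
Qed.

(** With q = p^m, the identity ((1+X)^q - 1) G_m = (1+X)^(pq) - 1 reads X^q G_m = X^(pq) modulo p,
    and X^q cancels. The value G_m(0) = p then gives the cofactor of p the constant term 1. *)
Lemma cycloE (p m : nat) : prime p ->
  exists t, cyclo p m = p%:R * (1 + 'X * t) + 'X^(p ^ m * (p - 1)).
Proof.
move=> pp; have p1 := prime_gt1 pp.
set q := (p ^ m)%N; have q0 : (0 < q)%N by rewrite expn_gt0 prime_gt0.
have [b Hb] := expr1DX_modp _ m pp; have [c Hc] := expr1DX_modp _ m.+1 pp.
have E : 'X^q * (cyclo p m - 'X^(q * (p - 1))) = p%:R * (c - b * cyclo p m).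
  have := subrX1 ((1 + 'X : {poly int}) ^+ q) p.
  rewrite -/(cyclo p m) -exprM -expnSr Hc Hb -/q => E.
  have -> : 'X^q * (cyclo p m - 'X^(q * (p - 1))) = 'X^q * cyclo p m - 'X^(p ^ m.+1).
    by rewrite mulrBr -exprD; congr (_ - 'X^_); rewrite expnSr -/q; nia.
  move: E; set u := 'X^q; set w := 'X^(p ^ m.+1) => E.
  apply/eqP; rewrite -subr_eq0; apply/eqP.
  have -> : u * cyclo p m - w - p%:R * (c - b * cyclo p m) =
     (1 + u + p%:R * b - 1) * cyclo p m - (1 + w + p%:R * c - 1) by ring.
  by rewrite E subrr.
(* Comparing coefficients of index [i + q] cancels ['X^q]. *)
have {}E : cyclo p m - 'X^(q * (p - 1)) = p%:R * drop_poly q (c - b * cyclo p m).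
  apply/polyP => i; have := congr1 (fun f : {poly int} => f`_(i + q)) E.
  by rewrite coefXnM ltnNge leq_addl /= addnK !mulr_natl !coefMn coef_drop_poly.
set h := drop_poly _ _ in E.
have h1 : h.[0] = 1.
  have := congr1 (horner^~ 0) E; rewrite mulr_natl hornerMn /cyclo hornerD hornerN.
  rewrite horner_sum hornerXn expr0n muln_eq0 [q == _]eqn0Ngt q0 subn_eq0 leqNgt p1 /= subr0.
  under eq_bigr do rewrite !hornerE !expr1n.
  rewrite sumr_const card_ord => Ep; apply: (@mulfI _ (p%:R : int)).
    by rewrite pnatr_eq0 -lt0n prime_gt0.
  by rewrite mulr1 mulr_natl -Ep.
have [t Ht] := polyXM_const h; exists t.
by rewrite -[cyclo p m](subrK 'X^(q * (p - 1))) E Ht h1.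
Qed.

Lemma mulX_pseries (p m : nat) : 'X * pseries p m = (1 + 'X) ^+ (p ^ m) - 1.
Proof.
rewrite exprDn big_ord_recl /= subn0 bin0 expr0 expr1n mulr1 mulr1n addrC addKr.
rewrite /pseries mulr_sumr; apply: eq_bigr => i _.
by rewrite expr1n mul1r /bump /= add1n exprS mulrCA mulr_natl.
Qed.

Lemma pseriesS (p m : nat) : pseries p m.+1 = pseries p m * cyclo p m.
Proof.
apply: (@mulfI _ 'X); first by rewrite polyX_eq0.
by rewrite mulrA !mulX_pseries expnSr exprM subrX1.
Qed.

Lemma pseries0 (p : nat) : pseries p 0 = 1.
Proof. by rewrite /pseries big_ord1 mulr1. Qed.

(** Induction on k: the pure power in [cyclo p k.+1] is a multiple of X^p, so modulo X^p this factor
    is p times a unit. *)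
Lemma pseries_trunc (p k : nat) : prime p -> exists t s,
  pseries p k.+1 = (1 + 'X * t) * (p%:R ^+ k.+1 + p%:R ^+ k * 'X^(p - 1)) + s * 'X^p.
Proof.
move=> pp; have p1 := prime_gt1 pp.
elim: k => [|k [t [s IH]]].
  (* Since (p - 1) + 1 = p, the product (1 + X t)(p + X^(p-1)) exceeds [cyclo p 0] by t X^p. *)
  have [t Ht] := cycloE _ 0 pp; exists t, (- t).
  rewrite pseriesS pseries0 mul1r Ht expn0 mul1n -[in 'X^p](@subnK 1 p); last by lia.
  by rewrite exprD !expr1 expr0; set u := 'X^_; ring.
have [t' Ht] := cycloE _ k.+1 pp.
exists (t + t' + 'X * t * t').
set e := (p ^ k.+1 * (p - 1))%N in Ht.
have pe : (p <= e)%N.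
  by rewrite /e expnS -[X in (X <= _)%N]muln1 -mulnA leq_mul2l muln_gt0 expn_gt0 /=; lia.
exists (s * cyclo p k.+1 +
  (1 + 'X * t) * (p%:R ^+ k.+1 + p%:R ^+ k * 'X^(p - 1)) * 'X^(e - p)).
rewrite pseriesS IH Ht -{1 2}(subnK pe) exprD !exprS.
set u := 'X^(e - p); set w := 'X^p; set x := 'X^(p - 1).
set c : {poly int} := p%:R; set d := c ^+ k; ring.
Qed.

(** * Units modulo X^n and the ideal (P_2, X^n) *)

Lemma expr_1DX (t : {poly int}) n : exists w, (1 + 'X * t) ^+ n = 1 + 'X * w.
Proof.
elim: n => [|n [w IH]]; first by exists 0; rewrite expr0 mulr0 addr0.
by exists (t + w + 'X * t * w); rewrite exprS IH; ring.
Qed.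

(** The inverse is the truncated geometric series of ratio -Xt. *)
Lemma inv_1DX (t : {poly int}) n :
  exists w r, (1 + 'X * t) * (1 + 'X * w) = 1 + r * 'X^n.
Proof.
exists (- t * \sum_(i < n) (- ('X * t)) ^+ i), ((- t) ^+ n * 'X * t).
have -> : 1 + 'X * (- t * \sum_(i < n) (- ('X * t)) ^+ i) = \sum_(i < n.+1) (- ('X * t)) ^+ i.
  rewrite big_ord_recl expr0; congr (_ + _); rewrite mulrA mulr_sumr.
  by apply: eq_bigr => i _; rewrite lift0 exprS mulrN.
have -> : 1 + 'X * t = - (- ('X * t) - 1) by ring.
rewrite mulNr -subrX1 exprS -mulrN exprMn.
by set u := 'X^n; set w := _ ^+ n; ring.
Qed.

(** These are the relations on a generator of row n: P_2 comes from ku_*(Z_{p^2}), and X^n lowers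
    row n to row 0, where everything vanishes. *)
Definition in_ideal (p n : nat) (f : {poly int}) : Prop :=
  exists q r, f = q * pseries p 2 + r * 'X^n.

Lemma in_idealD p n f g : in_ideal p n f -> in_ideal p n g -> in_ideal p n (f + g).
Proof. by move=> [q [r ->]] [s [t ->]]; exists (q + s), (r + t); rewrite !mulrDl addrACA. Qed.

Lemma in_idealMl p n f g : in_ideal p n g -> in_ideal p n (f * g).
Proof. by move=> [q [r ->]]; exists (f * q), (f * r); rewrite mulrDr !mulrA. Qed.

Lemma in_idealB p n f g : in_ideal p n f -> in_ideal p n g -> in_ideal p n (f - g).
Proof. by move=> If Ig; apply: in_idealD => //; rewrite -mulN1r; apply: in_idealMl. Qed.

Lemma in_ideal_pseries p n f : in_ideal p n (f * pseries p 2).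
Proof. by exists f, 0; rewrite mul0r addr0. Qed.

Lemma in_idealX p n m f : (n <= m)%N -> in_ideal p n (f * 'X^m).
Proof. by move=> nm; exists 0, (f * 'X^(m - n)); rewrite -mulrA -exprD subnK // mul0r add0r. Qed.

Lemma in_ideal_cancel p n t f : in_ideal p n ((1 + 'X * t) * f) -> in_ideal p n f.
Proof.
have [w [r E]] := inv_1DX t n => I.
have -> : f = (1 + 'X * w) * ((1 + 'X * t) * f) - r * f * 'X^n.
  rewrite mulrA [_ * (1 + 'X * t)]mulrC E; set u := 'X^n; ring.
by apply: in_idealB; [exact: in_idealMl | exact: in_idealX].
Qed.

(** [a - b] divides [a ^+ n - b ^+ n], and [(a - b) * d] is [e]. In the applications [c] and [d] are
    the two factors G_0, G_1 of [e] = P_2, in either order. *)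
Lemma expr_mul_factor (R : comNzRingType) (a b c d e : R) n : a - b = c -> c * d = e ->
  exists q, a ^+ n * d = b ^+ n * d + q * e.
Proof.
move=> <- <-; exists (\sum_(i < n) a ^+ (n.-1 - i) * b ^+ i).
by rewrite mulrA [_ * (a - b)]mulrC -subrXX mulrBl addrC subrK.
Qed.

(** * Trading powers of p for powers of X modulo P_2 *)

Section Ideal.
Variable p : nat.
Hypothesis pp : prime p.
Local Notation g := (p - 1)%N.
Variables t0 t1 : {poly int}.
Hypothesis E0 : cyclo p 0 = p%:R * (1 + 'X * t0) + 'X^g.
Hypothesis E1 : cyclo p 1 = p%:R * (1 + 'X * t1) + 'X^(p * g).
Local Notation P := (pseries p 2).
Local Notation U0 := (1 + 'X * t0).
Local Notation U1 := (1 + 'X * t1).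

Lemma pseries2E : P = cyclo p 0 * cyclo p 1.
Proof. by rewrite !pseriesS pseries0 mul1r. Qed.

Lemma cyclo1_shift m : exists q,
  p%:R ^+ m * U0 ^+ m * cyclo p 1 = (-1) ^+ m * 'X^(m * g) * cyclo p 1 + q * P.
Proof.
have [] := expr_mul_factor _ (p%:R * U0) (- 'X^g) (cyclo p 0) (cyclo p 1) P m.
- by rewrite opprK -E0.
- by rewrite pseries2E.
move=> q Hq; exists q; move: Hq.
by rewrite -exprMn => ->; rewrite (exprNn 'X^g) mulnC exprM.
Qed.

Lemma cyclo0_shift m : exists q,
  p%:R ^+ m * U1 ^+ m * cyclo p 0 = (-1) ^+ m * 'X^(m * (p * g)) * cyclo p 0 + q * P.
Proof.
have [] := expr_mul_factor _ (p%:R * U1) (- 'X^(p * g)) (cyclo p 1) (cyclo p 0) P m.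
- by rewrite opprK -E1.
- by rewrite pseries2E mulrC.
move=> q Hq; exists q; move: Hq.
by rewrite -exprMn => ->; rewrite (exprNn 'X^(p * g)) (mulnC m) (exprM _ (p * g)).
Qed.

(** Each p beyond the first is worth g degrees. In the induction one p U_1 is replaced by G_1 -
    X^(pg): the first family turns the G_1 term into a multiple of X^n, and the other term loses one
    p but gains pg degrees. *)
Lemma pexpX_in_ideal n m s : (n <= s + m * g)%N -> in_ideal p n (p%:R ^+ m.+1 * 'X^s).
Proof.
have g0 : (0 < g)%N by have := prime_gt1 pp; lia.
elim: m s => [|m IH] s le_n; first by apply: in_idealX; lia.
have [w Ew] := expr_1DX t0 m.+1; have [q Hq] := cyclo1_shift m.+1.
apply: (in_ideal_cancel _ _ w); apply: (in_ideal_cancel _ _ t1).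
have -> : U1 * ((1 + 'X * w) * (p%:R ^+ m.+2 * 'X^s)) =
  (q * 'X^s) * P + (-1) ^+ m.+1 * cyclo p 1 * 'X^(s + m.+1 * g)
   - U0 ^+ m.+1 * (p%:R ^+ m.+1 * 'X^(s + p * g)).
  rewrite -Ew. have -> : p%:R ^+ m.+2 = p%:R * p%:R ^+ m.+1 :> {poly int} by rewrite -exprS.
  have Hu : p%:R * U1 = cyclo p 1 - 'X^(p * g) by rewrite E1 addrK.
  rewrite (exprD _ s (m.+1 * g)) (exprD _ s (p * g)).
  transitivity ('X^s * ((p%:R ^+ m.+1 * U0 ^+ m.+1) * (p%:R * U1))).
    by move: (p%:R : {poly int}) (U0 ^+ _) => a b; move: (a ^+ _) ('X^s) => c d; ring.
  rewrite Hu mulrBr Hq.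
  move: (p%:R ^+ _) (U0 ^+ _) ('X^s) ('X^(p * g)) ('X^(m.+1 * g)) ((-1) ^+ _) => a b c d e f; ring.
apply: in_idealB; last by apply/in_idealMl/IH; nia.
by apply: in_idealD; [exact: in_ideal_pseries | exact: in_idealX].
Qed.

(** The same exchange with s = 0, one degree past the range of [pexpX_in_ideal]: X^(kg) G_1 no
    longer vanishes, but only the constant coefficient p of G_1 survives. *)
Lemma pexp_mod_ideal k : (0 < k)%N ->
  in_ideal p (k * g + 1) (p%:R ^+ k.+1 - (-1) ^+ k * p%:R * 'X^(k * g)).
Proof.
case: k => // k _; set n := (_ + 1)%N.
have g0 : (0 < g)%N by have := prime_gt1 pp; lia.
have [w Ew] := expr_1DX t0 k.+1; have [q Hq] := cyclo1_shift k.+1.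
apply: (in_ideal_cancel _ _ w); apply: (in_ideal_cancel _ _ t1).
have Hu : p%:R * U1 = cyclo p 1 - 'X^(p * g) by rewrite E1 addrK.
have EP : 'X^(p * g) = 'X * 'X^((p * g).-1) :> {poly int} by rewrite -exprS prednK // muln_gt0 prime_gt0.
have -> : U1 * ((1 + 'X * w) * (p%:R ^+ k.+2 - (-1) ^+ k.+1 * p%:R * 'X^(k.+1 * g))) =
  q * P + (-1) ^+ k.+1 * ('X^((p * g).-1) - p%:R * U1 * w) * 'X^n
   - U0 ^+ k.+1 * (p%:R ^+ k.+1 * 'X^(p * g)).
  rewrite -Ew. have -> : p%:R ^+ k.+2 = p%:R * p%:R ^+ k.+1 :> {poly int} by rewrite -exprS.
  transitivity ((p%:R ^+ k.+1 * U0 ^+ k.+1) * (p%:R * U1)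
     - (-1) ^+ k.+1 * (p%:R * U1) * U0 ^+ k.+1 * 'X^(k.+1 * g)).
    by move: (p%:R : {poly int}) (U0 ^+ _) => a b; move: (a ^+ _) ('X^_) ((-1) ^+ _) => c d e; ring.
  rewrite Hu mulrBr Hq Ew EP /n addn1 (exprS 'X (k.+1 * g)).
  move: (p%:R ^+ _) ('X^((p * g).-1)) ('X^(k.+1 * g)) ((-1) ^+ _) => a b c f.
  ring.
apply: in_idealB; last by apply/in_idealMl/pexpX_in_ideal; rewrite /n; nia.
by apply: in_idealD; [exact: in_ideal_pseries | exact: in_idealX].
Qed.

Lemma pexp_cyclo0_in_ideal k n : (n <= k.+1 * (p * g))%N -> in_ideal p n (p%:R ^+ k.+1 * cyclo p 0).
Proof.
move=> le_n; have [w Ew] := expr_1DX t1 k.+1; have [q Hq] := cyclo0_shift k.+1.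
apply: (in_ideal_cancel _ _ w).
rewrite -Ew mulrA [U1 ^+ _ * _]mulrC Hq addrC mulrAC.
by apply: in_idealD; [exact: in_ideal_pseries | exact: in_idealX].
Qed.

Lemma pexp_cyclo0_mod_ideal k : (0 < k)%N -> let n := (k * (p * g) + g + 1)%N in
  exists b, in_ideal p n (p%:R ^+ k * cyclo p 0 - (-1) ^+ k * 'X^(k * (p * g) + g)
                          - p%:R ^+ k.+1 * b).
Proof.
move=> k0 n; have p1 := prime_gt1 pp.
(* The inequality (k+1)g <= kpg leaves room to apply the first family with exponent k+1. *)
have [e De] : exists e, (k * (p * g) = e + k.+1 * g)%N.
  by exists (k * (p * g) - k.+1 * g)%N; rewrite subnK //; nia.
have [v Ev] := expr_1DX t1 k; have [q0 Hq0] := cyclo0_shift k.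
have [q1 Hq1] := cyclo1_shift k.+1.
have [w [r Ewr]] := inv_1DX v n; have [w' [r' Ewr']] := inv_1DX t1 n.
set W := 1 + 'X * w in Ewr; set W' := 1 + 'X * w' in Ewr'.
set f := 'X^(k * (p * g)) : {poly int}.
(* This is the chain (-1)^k W U_0 (p f), then p f = W' f G_1, then f G_1 = (-1)^(k+1) X^e p^(k+1)
   U_0^(k+1) G_1, with p^(k+1) removed; W and W' invert U_1^k and U_1 modulo X^n. *)
exists ((-1) ^+ k * W * U0 * W' * (-1) ^+ k.+1 * 'X^e * U0 ^+ k.+1 * cyclo p 1).
have Efe : f = 'X^e * 'X^(k.+1 * g) by rewrite /f De exprD.
have En : 'X^n = f * 'X^g * 'X by rewrite /n addn1 exprSr exprD.
have IE1 : in_ideal p n (p%:R ^+ k * cyclo p 0 - (-1) ^+ k * W * f * cyclo p 0).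
  have -> : p%:R ^+ k * cyclo p 0 - (-1) ^+ k * W * f * cyclo p 0 =
     (W * q0) * P - p%:R ^+ k * cyclo p 0 * r * 'X^n.
    move: Hq0; rewrite Ev -/f => Hq0.
    have -> : W * q0 * P = p%:R ^+ k * cyclo p 0 * ((1 + 'X * v) * W) - (-1) ^+ k * W * f * cyclo p 0.
      rewrite -mulrA -[q0 * P](addKr ((-1) ^+ k * f * cyclo p 0)) -Hq0.
      by move: (p%:R ^+ k) ((-1) ^+ k) => a c; ring.
    by rewrite Ewr; move: (p%:R ^+ k) ((-1) ^+ k) ('X^n) => a c d; ring.
  by apply: in_idealB; [exact: in_ideal_pseries | exact: in_idealX].
(* Here p U_1 = G_1 - X^(pg), and X^(pg) f = X^((k+1)pg) is a multiple of X^n. *)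
have IE2 : in_ideal p n (p%:R * f - W' * f * cyclo p 1).
  have -> : p%:R * f - W' * f * cyclo p 1 =
      (- (W' * 'X^(p * g + k * (p * g) - n)) - p%:R * f * r') * 'X^n.
    have Ee : 'X^(p * g + k * (p * g) - n) * 'X^n = 'X^(p * g) * f :> {poly int}.
      by rewrite -!exprD subnK // /n; nia.
    have Er : r' * 'X^n = U1 * W' - 1 by rewrite Ewr' addrC addKr.
    rewrite mulrBl mulNr -(mulrA W' 'X^(_ - n)) Ee -(mulrA _ r') Er E1.
    by move: ('X^(p * g)) => a; ring.
  exact: in_idealX.
have IE3 : in_ideal p n (f * cyclo p 1 -
    (-1) ^+ k.+1 * 'X^e * (p%:R ^+ k.+1 * U0 ^+ k.+1 * cyclo p 1)).
  rewrite Hq1 Efe.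
  set s := (-1) ^+ k.+1; have ss : s * s = 1 by rewrite -expr2 sqrr_sign.
  have -> : 'X^e * 'X^(k.+1 * g) * cyclo p 1 -
     s * 'X^e * (s * 'X^(k.+1 * g) * cyclo p 1 + q1 * P) = (- s * 'X^e * q1) * P.
    transitivity ((1 - s * s) * ('X^e * 'X^(k.+1 * g) * cyclo p 1) - s * 'X^e * q1 * P).
      by move: ('X^e) ('X^(k.+1 * g)) => a c; ring.
    by rewrite ss; move: ('X^e) => a; ring.
  exact: in_ideal_pseries.
(* In W f X^g only the constant term 1 of W matters; the rest is w X^n. *)
have IE4 : in_ideal p n ((-1) ^+ k * w * 'X^n) by exact: in_idealX.
have -> : p%:R ^+ k * cyclo p 0 - (-1) ^+ k * 'X^(k * (p * g) + g) - p%:R ^+ k.+1 *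
   ((-1) ^+ k * W * U0 * W' * (-1) ^+ k.+1 * 'X^e * U0 ^+ k.+1 * cyclo p 1) =
  (p%:R ^+ k * cyclo p 0 - (-1) ^+ k * W * f * cyclo p 0) +
  (-1) ^+ k * W * U0 * (p%:R * f - W' * f * cyclo p 1) +
  (-1) ^+ k * W * U0 * W' * (f * cyclo p 1 -
    (-1) ^+ k.+1 * 'X^e * (p%:R ^+ k.+1 * U0 ^+ k.+1 * cyclo p 1)) +
  (-1) ^+ k * w * 'X^n.
  rewrite exprD -/f En.
  have -> : (-1) ^+ k * W * f * cyclo p 0 =
     (-1) ^+ k * W * f * (p%:R * U0) + (-1) ^+ k * W * f * 'X^g by rewrite -mulrDr E0.
  rewrite /W; move: (p%:R ^+ k.+1) (p%:R ^+ k) ((-1) ^+ k.+1) ((-1) ^+ k) ('X^g) ('X^e)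
    (U0 ^+ k.+1) => a1 a2 a3 a4 a5 a6 a7; ring.
apply: in_idealD IE4; apply: in_idealD; last exact: in_idealMl.
by apply: in_idealD => //; exact: in_idealMl.
Qed.
End Ideal.

(** * The two boundaries as polynomial identities in x and z *)

(* In [{poly {poly int}}] the outer variable is x and the inner one is z;
   [liftx] places a polynomial in the outer variable. *)
Local Notation liftx := (map_poly (@polyC int)).

(** In column 1 the variable x acts as zero, so only the constant coefficient p^(k+1) of P_{k+1}
    counts. *)
Lemma pseries_boundary_one p k : prime p -> (0 < k)%N -> exists q r s : {poly {poly int}},
  liftx (pseries p k.+1) * 1 = (((-1) ^+ k * p%:R) *: 'X^(k * (p - 1)))%:P
   + q * (pseries p 2)%:P + r * ('X^(k * (p - 1) + 1))%:P + s * 'X^1.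
Proof.
move=> pp k0; have [t0 E0] := cycloE _ 0 pp; have [t1 E1] := cycloE _ 1 pp.
rewrite expn0 mul1n in E0; rewrite expn1 in E1.
have [q [r E]] := pexp_mod_ideal p pp t0 t1 E0 E1 k k0.
have [h Eh] := polyXM_const (pseries p k.+1).
exists q%:P, r%:P, (liftx h).
rewrite mulr1 {1}Eh rmorphD /= rmorphM /= map_polyC map_polyX /= [_ * liftx h]mulrC.
congr (_ + _); rewrite -!rmorphM -!rmorphD /=; congr (_%:P).
have -> : ((pseries p k.+1).[0])%:P = p%:R ^+ k.+1 :> {poly int}.
  have [t [s ->]] := pseries_trunc _ k pp; have p1 := prime_gt1 pp.
  have Ep : p%:R.[0] = p%:R :> int by rewrite -polyC_natr hornerC.
  rewrite !hornerE !expr0n subn_eq0 leqNgt p1 gtn_eqF ?(ltnW p1) //= !mulr0 !addr0 Ep.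
  by rewrite rmorphXn /= polyC_natr.
rewrite -mul_polyC rmorphM /= rmorph_sign polyC_natr.
by rewrite -addrA -E addrC subrK.
Qed.

(** With f = G_0 - x^g b, the product (p^(k+1) + p^k x^g) f is p^(k+1) G_0 + x^g (p^k G_0 - p^(k+1)
    b) - p^k b x^(2g), where 2g >= p kills the last term. *)
Lemma pseries_boundary_lift p k : prime p -> (0 < k)%N ->
  let g := (p - 1)%N in let n := (k * (p * g) + g + 1)%N in
  exists f q r s : {poly {poly int}}, f`_0`_0 = p%:Z /\
  liftx (pseries p k.+1) * f = ((-1) ^+ k *: 'X^(k * (p * g) + g))%:P * 'X^g
   + q * (pseries p 2)%:P + r * ('X^n)%:P + s * 'X^p.
Proof.
move=> pp k0 g n; have [t0 E0] := cycloE _ 0 pp; have [t1 E1] := cycloE _ 1 pp.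
rewrite expn0 mul1n in E0; rewrite expn1 in E1.
have p1 := prime_gt1 pp.
have [|q1 [r1 H1]] := pexp_cyclo0_in_ideal p t1 E1 k n; first by rewrite /n /g; nia.
have [b [q2 [r2 H2]]] := pexp_cyclo0_mod_ideal p pp t0 t1 E0 E1 k k0.
rewrite -/g -/n in H2.
have [t [s Et]] := pseries_trunc _ k pp; rewrite -/g in Et.
set Y := 1 + 'X * liftx t.
exists ((cyclo p 0)%:P - b%:P * 'X^g), (Y * (q1%:P + q2%:P * 'X^g)), (Y * (r1%:P + r2%:P * 'X^g)).
(* The three multiples of x^p: the nonconstant part of the unit [Y] times x^g, the x^(2g) term, and
   the remainder of the truncated P_{k+1}. *)
exists (liftx t * ((-1) ^+ k *: 'X^(k * (p * g) + g))%:P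
  - Y * (p%:R ^+ k * b)%:P * 'X^(g + g - p) + liftx s * ((cyclo p 0)%:P - b%:P * 'X^g)).
split.
  rewrite coefB coefC coefMXn /= subn_gt0 p1 subr0 E0 coefD coefXn eq_sym subn_eq0 leqNgt p1.
  by rewrite addr0 mulr_natl coefMn coefD coef1 coefXM /= addr0 natz.
have XX : 'X^g * 'X^g = 'X^(g + g - p) * 'X^p :> {poly {poly int}}.
  by rewrite -!exprD subnK // /g; lia.
have Xp : 'X^p = 'X^g * 'X :> {poly {poly int}} by rewrite -exprSr /g subn1 prednK // ltnW.
have El : liftx (pseries p k.+1) =
   Y * ((p%:R ^+ k.+1)%:P + (p%:R ^+ k)%:P * 'X^g) + liftx s * 'X^p.
  rewrite Et /Y !(rmorphD, rmorphM) /= map_polyX !map_polyXn !rmorphXn /= !rmorph_nat.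
  by rewrite rmorph1.
have {}H1 := congr1 (@polyC _) H1; have {}H2 := congr1 (@polyC _) H2.
rewrite !(rmorphB, rmorphD, rmorphM) /= in H1 H2.
rewrite El !(rmorphD, rmorphM) /=.
set A := (p%:R ^+ k.+1)%:P in H1 H2 *; set B := (p%:R ^+ k)%:P in H2 *.
set F := (cyclo p 0)%:P in H1 H2 *; set P := (pseries p 2)%:P in H1 H2 *.
set Z := ('X^n)%:P in H1 H2 *; set x := 'X^g in XX Xp *; set w := 'X^p in XX Xp *.
have -> : ((-1) ^+ k *: 'X^(k * (p * g) + g))%:P = ((-1) ^+ k)%:P * ('X^(k * (p * g) + g))%:P :> {poly {poly int}}.
  by rewrite -mul_polyC rmorphM /= !rmorph_sign.
set c := _ * ('X^(k * (p * g) + g))%:P in H2 *.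
transitivity (Y * (A * F) + Y * x * (B * F - c - A * b%:P) + c * x + liftx t * c * (x * 'X)
   - Y * B * b%:P * (x * x) + liftx s * w * (F - b%:P * x)).
  by rewrite /Y; ring.
by rewrite H1 H2 XX -Xp; ring.
Qed.

(** * Dictionary between formal terms and polynomials in x and z *)

(* Coefficient of [i0 - a, j0 - b] in the element of top degree [i0, j0] encoded by f;
   the power of v is forced by homogeneity. *)
Definition hcoef (f : {poly {poly int}}) (a b : int) : {poly rat} :=
  if (a, b) is (Posz s, Posz t) then (f`_s`_t)%:~R *: 'X^(s + t) else 0.

Lemma hcoefD f h a b : hcoef (f + h) a b = hcoef f a b + hcoef h a b.
Proof. by case: a b => s [] t; rewrite /hcoef ?addr0 // !coefD rmorphD scalerDl. Qed.

Lemma hcoef0 a b : hcoef 0 a b = 0.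
Proof. by case: a b => s [] t; rewrite /hcoef ?coef0 ?scale0r. Qed.

Lemma hcoef_sum I (s : seq I) (F : I -> {poly {poly int}}) a b :
  hcoef (\sum_(i <- s) F i) a b = \sum_(i <- s) hcoef (F i) a b.
Proof. exact: (big_morph (fun f => hcoef f a b) (fun f h => hcoefD f h a b) (hcoef0 a b)). Qed.

Lemma hcoef_natl n f a b : hcoef (n%:R * f) a b = n%:R * hcoef f a b.
Proof.
by rewrite !mulr_natl; elim: n => [|n IH]; rewrite ?mulr0n ?hcoef0 // !mulrS hcoefD IH.
Qed.

Lemma hcoefMX f a b : hcoef (f * 'X) a b = 'X * hcoef f (a - 1) b.
Proof.
case: a => [[|s]|s].
(* At a negative index [hcoef] is zero, like the coefficient of index 0 in a multiple of ['X]. *)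
- by rewrite (_ : 0%:Z - 1 = Negz 0) //; case: b => t; rewrite /hcoef ?coefMX ?coef0 ?scale0r mulr0.
- rewrite (_ : s.+1%:Z - 1 = s) ; last by lia.
   case: b => t; rewrite /hcoef ?mulr0 //.
  by rewrite coefMX /= addSn exprS scalerAr.
by rewrite NegzE -opprD -PoszD addn1 -NegzE /= mulr0.
Qed.

Lemma hcoefMXn f u a b : hcoef (f * 'X^u) a b = 'X^u * hcoef f (a - u%:Z) b.
Proof.
elim: u a => [|u IH] a; first by rewrite !expr0 mulr1 mul1r subr0.
by rewrite exprSr mulrA hcoefMX IH mulrA exprS -addrA -opprD -PoszD add1n.
Qed.

Lemma hcoefMY f a b : hcoef (f * 'X%:P) a b = 'X * hcoef f a (b - 1).
Proof.
case: b => [[|t]|t].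
- by rewrite (_ : 0%:Z - 1 = Negz 0) //; case: a => s; rewrite /hcoef ?coefMC ?coefMX ?scale0r mulr0.
- rewrite (_ : t.+1%:Z - 1 = t) ; last by lia.
   case: a => s; rewrite /hcoef ?mulr0 //.
  by rewrite coefMC coefMX /= addnS exprS scalerAr.
by rewrite NegzE -opprD -PoszD addn1 -NegzE; case: a => s; rewrite /hcoef mulr0.
Qed.

Lemma hcoefMYn f u a b : hcoef (f * ('X^u)%:P) a b = 'X^u * hcoef f a (b - u%:Z).
Proof.
elim: u b => [|u IH] b; first by rewrite !expr0 mulr1 mul1r subr0.
by rewrite exprSr rmorphM /= mulrA hcoefMY IH mulrA exprS -addrA -opprD -PoszD add1n.
Qed.

(** The right side has the shape of [coefAt_bd], so the boundary is multiplication by P_m(x);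
    likewise P_2(z) will match [coefAt_relcomb]. *)
Lemma hcoef_pseriesx p m f a b :
  hcoef (liftx (pseries p m) * f) a b =
  \sum_(u <- iota 0 (p ^ m)) acoef p m u * hcoef f (a - u%:Z) b.
Proof.
rewrite /pseries rmorph_sum mulr_suml hcoef_sum -[(p ^ m)%N in RHS]subn0 big_mkord.
apply: eq_bigr => u _; rewrite rmorphM /= rmorph_nat map_polyXn -mulrA hcoef_natl.
by rewrite mulrC [_ * f]mulrC hcoefMXn /acoef mulrC mulrA.
Qed.

Lemma hcoef_pseriesy p m f a b :
  hcoef (f * (pseries p m)%:P) a b =
  \sum_(u <- iota 0 (p ^ m)) acoef p m u * hcoef f a (b - u%:Z).
Proof.
rewrite /pseries rmorph_sum mulr_sumr hcoef_sum -[(p ^ m)%N in RHS]subn0 big_mkord.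
apply: eq_bigr => u _; rewrite rmorphM /= rmorph_nat mulrCA hcoef_natl.
by rewrite hcoefMYn /acoef mulrA.
Qed.

Lemma hcoef_monomial (c : int) (s t : nat) a b :
  hcoef ((c *: 'X^t)%:P * 'X^s) a b =
  if (a == s%:Z) && (b == t%:Z) then c%:~R *: 'X^(s + t) else 0.
Proof.
case: a b => a [] b; rewrite /hcoef ?andbF // coefMXn coefC !eqz_nat.
rewrite subn_eq0; case: (ltngtP a s) => [_|_|->] /=; rewrite ?coef0 ?scale0r //.
rewrite coefZ coefXn; case: eqP => [->|_]; by rewrite ?mulr1 // mulr0 scale0r.
Qed.

Lemma in_ku_monomial p c n : prime p -> in_ku p (c%:~R *: 'X^n).
Proof.
move=> pp; apply/(all_nthP 0) => i _; rewrite coefZ coefXn -[(i == n)%:R]/((i == n)%:Z%:~R).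
by rewrite -rmorphM /plocal denq_int dvdn1 neq_ltn prime_gt1 ?orbT.
Qed.

Lemma in_ku_hcoef p f a b : prime p -> in_ku p (hcoef f a b).
Proof.
move=> pp; case: a b => s [] t; rewrite /hcoef; try exact: in_ku_monomial.
all: by rewrite /in_ku polyseq0.
Qed.

(** Zero terms are dropped because the filtration bound is checked on every listed term, and a zero
    term at [(i0, j0)] would violate it. *)
Definition bipoly_terms (i0 j0 : int) (f : {poly {poly int}}) : seq term :=
  [seq t <- [seq (hcoef f s%:Z t%:Z, (i0 - s%:Z, j0 - t%:Z))
            | s <- iota 0 (size f), t <- iota 0 (size f`_s)] | t.1 != 0].

Lemma coefAt_bipoly_terms i0 j0 f i j :
  coefAt (bipoly_terms i0 j0 f) i j = hcoef f (i0 - i) (j0 - j).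
Proof.
rewrite /coefAt big_filter_cond /=.
transitivity (\sum_(t <- [seq (hcoef f s%:Z t%:Z, (i0 - s%:Z, j0 - t%:Z))
            | s <- iota 0 (size f), t <- iota 0 (size f`_s)] | t.2 == (i, j)) t.1).
  rewrite [RHS](bigID (fun t : term => t.1 != 0)) /= [X in _ = _ + X]big1 ?addr0.
    by apply: eq_bigl => t; rewrite andbC.
  by move=> t /andP[_ /negPn/eqP].
rewrite big_mkcond big_allpairs_dep /=.
have Ec (s t : nat) : ((i0 - s%:Z, j0 - t%:Z) == (i, j)) = (s%:Z == i0 - i) && (t%:Z == j0 - j).
  by rewrite xpair_eqE; congr (_ && _); lia.
under eq_bigr do under eq_bigr do rewrite Ec.
case: (i0 - i) => a; last by rewrite big1 // => s _; rewrite big1.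
case: (j0 - j) => b; last first.
  by rewrite big1 ?{2}/hcoef // => s _; rewrite big1 // => t _; rewrite andbF.
under eq_bigr => s _.
  under eq_bigr do rewrite !eqz_nat if_and.
  rewrite (_ : \sum_(t <- _) _ = if s == a then hcoef f a b else 0); first over.
  case: eqP => [->|_]; last by rewrite big1.
  rewrite -big_mkcond -[size _]subn0 big_nat1_eq /=; case: ltnP => // le.
  by rewrite /hcoef (nth_default _ le) scale0r.
rewrite -big_mkcond -[size _]subn0 big_nat1_eq /=; case: ltnP => // le.
by rewrite /hcoef (nth_default _ le) coef0 scale0r.
Qed.

Lemma coefAt_bd p m s i j :
  coefAt (bd p m s) i j = \sum_(u <- iota 0 (p ^ m)) acoef p m u * coefAt s (i + u%:Z) j.
Proof.
rewrite /coefAt /bd big_mkcond big_flatten big_map.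
under eq_bigr do rewrite big_map.
rewrite exchange_big; apply: eq_bigr => u _; rewrite mulr_sumr [RHS]big_mkcond.
apply: eq_bigr => -[c [a b]] _ /=; rewrite !xpair_eqE subr_eq.
by case: ifP => // _; rewrite mulrC.
Qed.

Lemma coefAt_relcomb p r i j :
  coefAt (relcomb p r) i j = \sum_(u <- iota 0 (p ^ 2)) acoef p 2 u * coefAt r i (j + u%:Z).
Proof.
rewrite /coefAt /relcomb big_mkcond big_flatten big_map.
under eq_bigr do rewrite /scale /relM !big_map.
rewrite exchange_big; apply: eq_bigr => u _; rewrite mulr_sumr [RHS]big_mkcond.
apply: eq_bigr => -[c [a b]] _ /=; rewrite !xpair_eqE subr_eq.
by case: ifP => // _; rewrite mulrC.
Qed.

(** The quotient [q] supplies the combination of relations. At positive (i, j) the cofactors [s] and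
    [r] are read at the negative indices -i and -j, hence contribute nothing. *)
Lemma tens_eq_bipoly p m (i0 j0 : nat) f h q r s x y : prime p ->
  liftx (pseries p m) * f = h + q * (pseries p 2)%:P + r * ('X^j0)%:P + s * 'X^i0 ->
  (forall i j, coefAt x i j = hcoef f (i0%:Z - i) (j0%:Z - j)) ->
  (forall i j, coefAt y i j = hcoef h (i0%:Z - i) (j0%:Z - j)) ->
  tens_eq p (bd p m x) y.
Proof.
move=> pp E Hx Hy; exists (bipoly_terms i0 j0 q); split.
  apply/allP => t; rewrite mem_filter => /andP[_ /allpairsPdep[a [b [_ _ ->]]]].
  exact: in_ku_hcoef.
have hcoef_neg1 e (a b : int) : a < 0 -> hcoef e a b = 0 by case: a.
have hcoef_neg2 e (a b : int) : b < 0 -> hcoef e a b = 0 by case: a b => a [].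
move=> i j i_gt0 j_gt0; rewrite coefAt_bd coefAt_relcomb Hy.
under eq_bigr do rewrite Hx opprD addrA.
under [in RHS]eq_bigr do rewrite coefAt_bipoly_terms opprD addrA.
rewrite -hcoef_pseriesx -hcoef_pseriesy E !hcoefD hcoefMXn hcoefMYn.
rewrite [hcoef s _ _]hcoef_neg1 ?[hcoef r _ _]hcoef_neg2; [|lia|lia].
by rewrite !mulr0 !addr0 addrAC subrr add0r.
Qed.

Lemma ku_unit_sign p k : prime p -> ku_unit p ((-1) ^+ k).
Proof.
move=> pp; have I : in_ku p ((-1) ^+ k).
  have -> : (-1) ^+ k = ((-1) ^+ k)%:~R *: 'X^0 :> {poly rat}.
    by rewrite rmorph_sign expr0 -mul_polyC rmorph_sign mulr1.
  exact: in_ku_monomial.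
by split=> //; exists ((-1) ^+ k); split=> //; rewrite -expr2 sqrr_sign.
Qed.

Lemma coefAt_cons t s i j :
  coefAt (t :: s) i j = (if t.2 == (i, j) then t.1 else 0) + coefAt s i j.
Proof. by rewrite /coefAt big_cons; case: ifP; rewrite ?add0r. Qed.

Lemma coefAt_nil i j : coefAt [::] i j = 0.
Proof. by rewrite /coefAt big_nil. Qed.

Lemma coefAt_monomial (i0 j0 i1 j1 : int) (s t : nat) c d i j :
  i0 = i1 + s%:Z -> j0 = j1 + t%:Z -> d = c%:~R *: 'X^(s + t) ->
  coefAt [:: (d, (i1, j1))] i j = hcoef ((c *: 'X^t)%:P * 'X^s) (i0 - i) (j0 - j).
Proof.
move=> -> -> ->; rewrite coefAt_cons coefAt_nil addr0 hcoef_monomial xpair_eqE /=.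
by congr (if _ && _ then _ else _); lia.
Qed.

Theorem theorem5p5 (p k : nat) : prime p -> (2 <= k)%N ->
  (exists u : {poly rat}, ku_unit p u /\
     tens_eq p (bd p k.+1 [:: (1, (1%:Z, (k * g1 p + 1)%N%:Z))])
               [:: (u * p%:R * 'X^(k * g1 p), (1%:Z, 1%:Z))])
  /\
  (exists (x : seq term) (u' : {poly rat}),
     all (fun t : term => in_ku p t.1 &&
            (filt p k t.2 < filt p k (p%:Z, ((p * k + 1) * g1 p + 1)%N%:Z))) x /\
     ku_unit p u' /\
     tens_eq p (bd p k.+1 ((p%:R, (p%:Z, ((p * k + 1) * g1 p + 1)%N%:Z)) :: x))
               [:: (u' * 'X^((k * p + 2) * g1 p), (1%:Z, 1%:Z))]).
Proof.
move=> pp k2; have k0 : (0 < k)%N by exact: ltnW.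
have p1 := prime_gt1 pp; split.
  exists ((-1) ^+ k); split; first exact: ku_unit_sign.
  have [q [r [s E]]] := pseries_boundary_one p k pp k0.
  apply: (tens_eq_bipoly _ _ _ _ _ _ _ _ _ _ _ pp E) => i j.
    have -> : 1 = (1 *: 'X^0)%:P * 'X^0 :> {poly {poly int}} by rewrite !expr0 scale1r mulr1.
    by apply: coefAt_monomial; rewrite ?addr0 // expr0 scale1r.
  have M0 (h : {poly {poly int}}) : h = h * 'X^0 by rewrite expr0 mulr1.
  rewrite [_%:P]M0; apply: coefAt_monomial; rewrite ?addr0 //.
    by rewrite PoszD addrC.
  by rewrite add0n -mul_polyC !rmorphM !rmorph_sign /= rmorph_nat polyC_natr.
have [f [q [r [s [f00 E]]]]] := pseries_boundary_lift p k pp k0.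
set n := (_ + 1)%N in E.
have -> : ((p * k + 1) * g1 p + 1)%N = n by rewrite /n /g1 mulnDl mul1n mulnCA mulnA.
(* The constant coefficient of [f] is the leading term p[p,n]; the remainder [e] encodes the
   correction x. *)
have [e [Ef e00]] : exists e, f = (p%:Z)%:P%:P + e /\ e`_0`_0 = 0.
  exists (f - (p%:Z)%:P%:P); split; first by rewrite addrC subrK.
  by rewrite !coefB f00 !coefC subrr.
exists (bipoly_terms p n e), ((-1) ^+ k); split; last split; first 1 last.
- exact: ku_unit_sign.
- apply: (tens_eq_bipoly _ _ _ _ _ _ _ _ _ _ _ pp E) => i j.
    rewrite coefAt_cons coefAt_bipoly_terms Ef hcoefD.
    congr (_ + _).
    have -> : (p%:Z)%:P%:P = (p%:Z *: 'X^0)%:P * 'X^0 :> {poly {poly int}}.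
      by rewrite !expr0 mulr1 alg_polyC.
    rewrite -(coefAt_monomial _ _ p n _ _ _ p%:R); rewrite ?coefAt_cons ?coefAt_nil ?addr0 //.
    by rewrite expr0 alg_polyC -polyC_natr.
  (* From [p,n] to [1,1] the drops are g and kpg + g, whence the exponent (kp + 2)g of v. *)
  apply: coefAt_monomial; rewrite ?/n ?/g1; [lia | lia |].
  rewrite -mul_polyC rmorph_sign rmorph_sign; congr (_ * 'X^_); lia.
apply/allP => t; rewrite mem_filter => /andP[nz /allpairsPdep[a [b [_ _ Et]]]].
rewrite Et in nz *; rewrite in_ku_hcoef //= /filt /=.
(* A nonzero term of [e] lies off the top position, and both weights in [filt] are positive, so its
   filtration is strictly smaller. *)
have : (a != 0)%N || (b != 0)%N.
  apply: contraNT nz; rewrite negb_or !negbK => /andP[/eqP -> /eqP ->].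
  by rewrite /hcoef e00 scale0r.
move=> ab; rewrite -subr_gt0.
set A := (p ^ k.+1)%:Z; set B := (p ^ k)%:Z.
have -> : p%:Z * (A + 1) + n%:Z * (B + 1) - ((p%:Z - a%:Z) * (A + 1) + (n%:Z - b%:Z) * (B + 1))
  = (a * (p ^ k.+1 + 1) + b * (p ^ k + 1))%N%:Z by rewrite !(PoszD, PoszM) -/A -/B; ring.
rewrite ltz_nat; nia.
Qed.
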